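(* Every weakly linearly convex balanced domain $D\subset\mathbb C^n$ is convex.
   Context: A domain $D\subset\mathbb C^n$ is balanced if $\lambda z\in D$ for all $z\in D$ and all $\lambda\in\mathbb C$ with $|\lambda|\le1$. A domain $D\subset\mathbb C^n$ is weakly linearly convex if each point of $\partial D$ belongs to a complex (affine) hyperplane disjoint from $D$. *)

(* Defs.v *)
From HB Require Import structures.
From mathcomp Require Import all_boot all_order all_algebra.
From mathcomp Require Import complex.
From mathcomp Require Import all_classical all_reals all_analysis.

Set Implicit Arguments.
Unset Strict Implicit.
Unset Printing Implicit Defensive.

Import Order.TTheory GRing.Theory Num.Theory.
Import numFieldNormedType.Exports.

Local Open Scope classical_set_scope.
Local Open Scope ring_scope.
Local Open Scope complex_scope.

(* The canonical topology of a numeric field is not inferred through the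
   constructor [complex], hence this copy of the metric topology of [`|_|]. *)
HB.instance Definition _ (R : realType) := NormedModule.copy R[i] R[i]^o.

Definition domain (T : topologicalType) (D : set T) : Prop :=
  [/\ D !=set0, open D & connected D].

Definition boundary (T : topologicalType) (D : set T) : set T :=
  closure D `\` interior D.

Definition balanced (R : realType) (n : nat) (D : set 'rV[R[i]]_n) : Prop :=
  forall (z : 'rV[R[i]]_n) (l : R[i]), D z -> `|l| <= 1 -> D (l *: z).

Definition complex_hyperplane (R : realType) (n : nat)
    (H : set 'rV[R[i]]_n) : Prop :=
  exists (a : 'rV[R[i]]_n) (c : R[i]),
    a != 0 /\ H = [set z | \sum_(j < n) a 0 j * z 0 j = c].

Definition weakly_linearly_convex (R : realType) (n : nat)
    (D : set 'rV[R[i]]_n) : Prop :=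
  forall p, boundary D p ->
    exists H, [/\ complex_hyperplane H, H p & H `&` D = set0].

(* [convex_set] is used with scalars in [R[i]]; this is ordinary (real)
   convexity because the order of [R[i]] only compares complex numbers whose
   difference is real, so that [0 <= t <= 1] in [R[i]] forces [t] to be real. *)
Lemma convex_set_realE (R : realType) (n : nat) (D : set 'rV[R[i]]_n) :
  convex_set D <->
  forall (x y : 'rV[R[i]]_n) (t : R), D x -> D y -> 0 <= t <= 1 ->
    D (t%:C *: x + (1 - t)%:C *: y).
Proof.
split=> [cD x y t Dx Dy /andP[t0 t1]|cD x y l /set_mem Dx /set_mem Dy].
  have t0' : 0 <= t%:C by rewrite lecR.
  have t1' : t%:C <= 1 by rewrite lecR.
  have := cD x y (Itv01 t0' t1') (mem_set Dx) (mem_set Dy).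
  by move/set_mem; rewrite rmorphB rmorph1.
have l0 : 0 <= l%:num by [].
have l1 : l%:num <= 1 by [].
have lE : l%:num = (complex.Re l%:num)%:C.
  by case: (l%:num) l0 => u v; rewrite lecE /= => /andP[/eqP -> _].
apply/mem_set.
suff : D (l%:num *: x + (1 - l%:num) *: y) by [].
rewrite lE -[1]/(1%:C) -rmorphB; apply: cD => //.
by rewrite -!lecR -lE l0 l1.
Qed.

(* Main.v *)
Require Import Defs.
From mathcomp Require Import all_boot all_order all_algebra.
From mathcomp Require Import complex.
From mathcomp Require Import all_classical all_reals all_analysis.

Set Implicit Arguments.
Unset Strict Implicit.
Unset Printing Implicit Defensive.

Import Order.TTheory GRing.Theory Num.Theory.
Import numFieldNormedType.Exports.

Local Open Scope classical_set_scope.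
Local Open Scope ring_scope.
Local Open Scope complex_scope.

(** Each boundary point [p] of [D] lies on a hyperplane [a . z = c] that misses
    [D].  Because [D] is balanced, it misses all the rotated and dilated copies
    [a . z = l * c] with [1 <= `|l|] as well, so that the single hyperplane
    confines [D] to the slab [`|a . z| < `|c|] ([balanced_slab]), which is
    convex.  Conversely, if [w] is outside [D], the segment from [0] (a point
    of [D]) to [w] crosses the boundary of [D] at some [s *: w] with
    [0 <= s <= 1] ([segment_meets_boundary]), where [a . (s *: w) = c] gives
    [`|c| <= `|a . w|]: thus [w] is outside the slab of that boundary point.
    Hence [D] is the intersection of its slabs, and is convex. *)

(** On [A], a set [D] that has no boundary point in [A] agrees with its closure,
    hence is both open and closed relative to [A]. *)
Lemma connected_sub_open (T : topologicalType) (A D : set T) :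
  open D -> connected A -> A `&` D !=set0 -> A `&` boundary D = set0 ->
  A `<=` D.
Proof.
move=> oD cA AD0 AbD; apply/setIidPl.
apply: cA => //; first by exists D.
exists (closure D); first exact: closed_closure.
apply/seteqP; split=> x [Ax Dx]; split=> //; first exact: subset_closure.
apply: contrapT => nDx.
suff : (A `&` boundary D) x by rewrite AbD.
by split=> //; split=> // /interior_subset.
Qed.

Lemma continuous_real_complex (R : realType) :
  continuous (fun s : R => s%:C : R[i]).
Proof.
move=> s; apply/cvgrPdist_lt => e e0.
(* A positive element of [R[i]] is real. *)
have eE : e = (complex.Re e)%:C.
  by case: e e0 => u v; rewrite ltcE /= => /andP[/eqP -> _].
move: e0; rewrite eE ltcR => e0.
near=> t.
rewrite -rmorphB /= normc_def /= expr0n addr0 sqrtr_sqr ltcR.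
near: t; exact: cvgr_dist_lt.
Unshelve. all: by end_near. Qed.

Lemma continuous_real_ray (R : realType) (n : nat) (w : 'rV[R[i]]_n) :
  continuous (fun s : R => s%:C *: w).
Proof.
move=> s.
apply: (@continuous_comp _ _ _ (fun s : R => s%:C : R[i]) (fun k => k *: w)).
  exact: continuous_real_complex.
exact: scalel_continuous.
Qed.

Lemma segment_meets_boundary (R : realType) (n : nat) (D : set 'rV[R[i]]_n)
    (w : 'rV[R[i]]_n) :
  open D -> D 0 -> ~ D w ->
  exists2 s : R, 0 <= s <= 1 & boundary D (s%:C *: w).
Proof.
move=> oD D0 nDw; apply: contrapT => nb; apply: nDw.
pose f (s : R) := s%:C *: w.
have cA : connected (f @` `[0, 1]).
  apply: connected_continuous_connected (@segment_connected R 0 1) _.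
  apply: continuous_subspaceT => s; exact: continuous_real_ray.
have fA s : 0 <= s <= 1 -> (f @` `[0, 1]) (f s).
  by move=> s01; exists s; rewrite //= in_itv.
have -> : w = f 1 by rewrite /f rmorph1 scale1r.
apply: (connected_sub_open oD cA); last by apply: fA; rewrite ler01 lexx.
  exists (f 0); split; first by apply: fA; rewrite lexx ler01.
  by rewrite /f rmorph0 scale0r.
apply/seteqP; split=> // _ [[s /= s01 <-] bs]; apply: nb.
by exists s; move: s01; rewrite // in_itv.
Qed.

Definition linear_form (K : fieldType) (n : nat) (a z : 'rV[K]_n) : K :=
  \sum_(j < n) a 0 j * z 0 j.

Lemma linear_formZ (K : fieldType) (n : nat) (a : 'rV[K]_n) k z :
  linear_form a (k *: z) = k * linear_form a z.
Proof. by rewrite mulr_sumr; apply: eq_bigr => j _; rewrite mxE mulrCA. Qed.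

Lemma linear_formD (K : fieldType) (n : nat) (a : 'rV[K]_n) z1 z2 :
  linear_form a (z1 + z2) = linear_form a z1 + linear_form a z2.
Proof. by rewrite -big_split; apply: eq_bigr => j _; rewrite mxE mulrDr. Qed.

Lemma balanced0 (R : realType) (n : nat) (D : set 'rV[R[i]]_n) :
  balanced D -> D !=set0 -> D 0.
Proof.
by move=> bD [z Dz]; rewrite -(scale0r z); apply: bD; rewrite ?normr0.
Qed.

(** If [`|c| <= `|v|] for [v = a . z] with [z] in [D], then [(c / v) *: z] is
    still in [D] and lies on the hyperplane [a . z = c].  For [v = 0] the
    inequality forces [c = 0], and [0] is the common point. *)
Lemma balanced_slab (R : realType) (n : nat) (D : set 'rV[R[i]]_n)
    (a : 'rV[R[i]]_n) (c : R[i]) :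
  balanced D -> [set z | linear_form a z = c] `&` D = set0 ->
  forall z, D z -> `|linear_form a z| < `|c|.
Proof.
move=> bD HD z Dz; set v := linear_form a z.
rewrite real_ltNge ?normr_real //; apply/negP => cv.
suff : ([set z | linear_form a z = c] `&` D) ((c / v) *: z) by rewrite HD.
split; rewrite /= ?linear_formZ -/v.
  have [v0|vN0] := eqVneq v 0; last by rewrite divfK.
  by rewrite v0 mulr0; apply/esym/eqP; rewrite -normr_le0 (le_trans cv) // v0 normr0.
have [->|vN0] := eqVneq v 0.
  by rewrite invr0 mulr0 scale0r; apply: balanced0 => //; exists z.
by apply: bD => //; rewrite normrM normfV ler_pdivrMr ?normr_gt0 // mul1r.
Qed.

Lemma norm_convex_lt (R : realType) (t : R) (u v d : R[i]) :
  0 <= t <= 1 -> `|u| < d -> `|v| < d ->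
  `|t%:C * u + (1 - t)%:C * v| < d.
Proof.
move=> /andP[t0 t1] ud vd; apply: le_lt_trans (ler_normD _ _) _.
have normC (r : R) : 0 <= r -> `|r%:C| = r%:C.
  by move=> r0; rewrite ger0_norm // lecR.
rewrite !normrM !normC ?subr_ge0 //.
have [->|tN0] := eqVneq t 0.
  by rewrite subr0 rmorph0 rmorph1 mul0r add0r mul1r.
have -> : d = t%:C * d + (1 - t)%:C * d.
  by rewrite -mulrDl -rmorphD /= addrC subrK rmorph1 mul1r.
apply: ltr_leD; first by rewrite ltr_pM2l // ltcR lt_def tN0.
by apply: ler_wpM2l (ltW vd); rewrite lecR subr_ge0.
Qed.

Theorem proposition5p1 (R : realType) (n : nat) (D : set 'rV[R[i]]_n) :
  domain D -> balanced D -> weakly_linearly_convex D -> convex_set D.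
Proof.
move=> [D_ne oD _] bD wD; apply/convex_set_realE => x y t Dx Dy t01.
apply: contrapT; set w := _ + _ => nDw.
have [s /andP[s0 s1] /wD[_ [[a [c [_ ->]]] Hp HD]]] :=
  segment_meets_boundary oD (balanced0 bD D_ne) nDw.
have slab := balanced_slab bD HD.
have w_in_slab : `|linear_form a w| < `|c|.
  by rewrite linear_formD !linear_formZ norm_convex_lt //; exact: slab.
have w_off_slab : `|c| <= `|linear_form a w|.
  have <- : linear_form a (s%:C *: w) = c by [].
  rewrite linear_formZ normrM ger0_norm ?lecR // ler_piMl //.
  by rewrite -[1]/(1%:C) lecR.
by move: (le_lt_trans w_off_slab w_in_slab); rewrite ltxx.
Qed.
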